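(* There is no online bin covering algorithm with advice complexity $o(\log\log n)$ whose competitive ratio is strictly better (larger) than $1/2$. That is, for every online bin covering algorithm $A$ with advice complexity $s(n)\in o(\log\log n)$ and every constant $\mu>0$, $A$ is not $(1/2+\mu)$-competitive.
   Context: Bin covering: items with sizes in $(0,1]$ arrive online and each must be irrevocably placed into a bin; a bin is covered if the total size of its items is at least $1$; the goal is to maximize the number of covered bins. In the advice-on-tape model, an oracle with unlimited power writes an advice string on a tape beforehand; the decision for the $i$-th item may depend on the advice and the sizes of the first $i$ items. $A(\sigma)$ is the number of bins covered by $A$ on $\sigma$ and $\mathrm{OPT}(\sigma)$ the maximum possible number. $A$ is $c$-competitive with advice complexity $s(n)$ if there is a constant $b$ such that for all $n$ and all input sequences $\sigma$ of length at most $n$ there is an advice string $\Phi$ such that $A(\sigma)\ge c\cdot \mathrm{OPT}(\sigma)-b$ and $A$ reads at most $s(n)$ bits of $\Phi$. The competitive ratio is the supremum of all $c$ for which $A$ is $c$-competitive. *)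

(* Defs.v *)
From HB Require Import structures.
From mathcomp Require Import all_boot all_order all_algebra.
From mathcomp Require Import all_classical all_reals all_analysis.
Set Implicit Arguments.
Unset Strict Implicit.
Unset Printing Implicit Defensive.
Import Order.TTheory GRing.Theory Num.Theory.
Import numFieldNormedType.Exports.
Local Open Scope ring_scope.

(* A packing of [sigma : seq R] is a sequence [B : seq nat] of the same size:
   item number i goes into the bin labelled by the i-th entry of [B]. *)

Definition valid_input (R : realType) (sigma : seq R) : bool :=
  all (fun x => 0 < x <= 1) sigma.

Definition bin_level (R : realType) (sigma : seq R) (B : seq nat) (b : nat) : R :=
  \sum_(p <- zip B sigma | p.1 == b) p.2.

(* [undup B] lists the nonempty bins; an empty bin is never covered. *)
Definition ncovered (R : realType) (sigma : seq R) (B : seq nat) : nat :=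
  count (fun b => 1 <= bin_level sigma B b) (undup B).

(* At most [size sigma] bins are nonempty, so labels below [size sigma]
   account for all packings up to renaming of the bins. *)
Definition OPT (R : realType) (sigma : seq R) : nat :=
  \max_(B : (size sigma).-tuple 'I_(size sigma))
     ncovered sigma [seq val b | b <- B].

(* The tape is infinite and is read from left to right. [place phi sigma] is
   the bin that receives the last item of [sigma], where [sigma] is the part of
   the input revealed so far; [nread phi sigma] is the number of bits of [phi]
   read by the time this item is placed. [advice_use] says that the algorithm
   has no access to the tape beyond the bits it has read. *)
Definition tape := nat -> bool.

Record online_algorithm (R : realType) := OnlineAlgorithm {
  place : tape -> seq R -> nat ;
  nread : tape -> seq R -> nat ;
  nread_rcons : forall (phi : tape) (sigma : seq R) (x : R),
    (nread phi sigma <= nread phi (rcons sigma x))%N ;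
  advice_use : forall (phi psi : tape) (sigma : seq R),
    (forall i : nat, (i < nread phi sigma)%N -> phi i = psi i) ->
    place phi sigma = place psi sigma /\ nread phi sigma = nread psi sigma
}.

Definition run (R : realType) (A : online_algorithm R) (phi : tape)
    (sigma : seq R) : seq nat :=
  mkseq (fun i => place A phi (take i.+1 sigma)) (size sigma).

Definition competitive_with_advice (R : realType) (A : online_algorithm R)
    (c : R) (s : nat -> nat) : Prop :=
  exists b : R, forall (n : nat) (sigma : seq R),
    valid_input sigma -> (size sigma <= n)%N ->
    exists phi : tape,
      (ncovered sigma (run A phi sigma))%:R >= c * (OPT sigma)%:R - b /\
      (nread A phi sigma <= s n)%N.

(* Main.v *)
(* For each scale [k = 2 ^ j], feed the algorithm [m = 2 ^ M] tiny items of size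
   [1 / (2 m)], then [L = m / k] large items of size [1 - k / (2 m)]. The optimum
   covers [L] bins. The algorithm covers at most [(L + N_k) / 2], where [N_k]
   counts the bins that received at least [k] tiny items, so beating the ratio
   [1 / 2] by [mu] forces [N_k >= 2 mu L - O(1)]. The tiny items are the same for
   all scales, and a packing of [m] items satisfies [\sum_j 2 ^ j N_(2 ^ j) <= 2 m]:
   it serves [O(1 / mu)] scales only. Serving about [M = log m] scales therefore
   takes [Omega(mu M)] distinct advice strings, while [s] bits provide [2 ^ s],
   which is eventually at most [sqrt (log n)]. *)

Require Import Defs.
From HB Require Import structures.
From mathcomp Require Import all_boot all_order all_algebra.
From mathcomp Require Import all_classical all_reals all_analysis.
From mathcomp Require Import zify lra.
Set Implicit Arguments.
Unset Strict Implicit.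
Unset Printing Implicit Defensive.
Import Order.TTheory GRing.Theory Num.Theory.
Import numFieldNormedType.Exports.
Local Open Scope classical_set_scope.
Local Open Scope ring_scope.

(** * Double counting of bins over dyadic scales *)

Lemma sum_count_mem_uniq (T : eqType) (r P : seq T) :
  uniq r -> {subset P <= r} -> (\sum_(b <- r) count_mem b P = size P)%N.
Proof.
move=> ur; elim: P => [|x P IH] sub /=; first by rewrite big1_eq.
rewrite big_split /= IH; last by move=> y yP; apply: sub; rewrite inE yP orbT.
suff -> : (\sum_(b <- r) (x == b) = 1)%N by [].
have <- : count_mem x r = 1%N by rewrite count_uniq_mem // sub // mem_head.
rewrite -sum1_count [RHS]big_mkcond; apply: eq_bigr => b _.
by rewrite /= eq_sym; case: (b == x).
Qed.

(** The powers of two up to [t] form a geometric series, bounded by twice its last term. *)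
Lemma sum_pow2_leq (t J : nat) : (\sum_(j < J) 2 ^ j * (2 ^ j <= t) <= 2 * t)%N.
Proof.
elim: J => [|J IH]; first by rewrite big_ord0.
case: (leqP (2 ^ J) t) => ht.
  apply: (@leq_trans (\sum_(j < J.+1) 2 ^ j)%N).
    by apply: leq_sum => j _; case: (_ <= t)%N; rewrite ?muln1 ?muln0.
  have : (\sum_(j < J.+1) 2 ^ j = (2 ^ J.+1).-1)%N.
    by rewrite predn_exp mul1n.
  move=> ->; rewrite expnS; lia.
by rewrite big_ord_recr /= [(_ ^ J <= t)%N]leqNgt ht muln0 addn0.
Qed.

Definition nbins_with (k : nat) (P : seq nat) : nat :=
  count (fun b => k <= count_mem b P)%N (undup P).

(** After exchanging the sums, a bin with [t] items contributes [2 ^ j] for each [j < J] with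
    [2 ^ j <= t], so at most [2 * t]. *)
Lemma sum_nbins_with (P : seq nat) (J : nat) :
  (\sum_(j < J) 2 ^ j * nbins_with (2 ^ j) P <= 2 * size P)%N.
Proof.
rewrite -(@sum_count_mem_uniq _ (undup P) P) ?undup_uniq //; last first.
  by move=> x; rewrite mem_undup.
rewrite big_distrr /=.
under eq_bigr do rewrite /nbins_with -sum1_count big_mkcond big_distrr /=.
rewrite exchange_big /=; apply: leq_sum => b _.
apply: leq_trans (sum_pow2_leq (count_mem b P) J).
by apply: leq_sum => j _; case: ifP.
Qed.

(** * The hard inputs: bin levels, optimum and covering bound *)

Section Levels.
Context (R : realType).
Implicit Types (x e : R) (B : seq nat).

Lemma bin_level_nseq x m B b :
  size B = m -> bin_level (nseq m x) B b = x *+ count_mem b B.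
Proof.
rewrite /bin_level => <-; elim: B => [|c B IH] /=; first by rewrite big_nil.
by rewrite big_cons /= IH; case: (c == b); rewrite ?mulrS.
Qed.

Lemma bin_level_nseq2 e x m L B1 B2 b : size B1 = m -> size B2 = L ->
  bin_level (nseq m e ++ nseq L x) (B1 ++ B2) b
  = e *+ count_mem b B1 + x *+ count_mem b B2.
Proof.
move=> h1 h2; rewrite -(@bin_level_nseq e m B1) // -(@bin_level_nseq x L B2) //.
by rewrite /bin_level zip_cat ?size_nseq // big_cat.
Qed.

(** The doubling keeps all [m] tiny items together at level 1/2. *)
Definition tiny_size (m : nat) : R := (m.*2%:R)^-1.
Definition hard_input (m k L : nat) : seq R :=
  nseq m (tiny_size m) ++ nseq L (1 - tiny_size m *+ k).

Lemma tiny_size_mul (m k : nat) : (0 < m)%N -> (k <= m)%N ->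
  0 < tiny_size m <= 1 /\ tiny_size m *+ k <= 1 / 2.
Proof.
move=> m0 km; rewrite /tiny_size.
have h : 0 < m%:R :> R by rewrite ltr0n.
have e : (m.*2%:R)^-1 * m%:R = 1 / 2 :> R.
  by rewrite -muln2 natrM invfM mulrAC mulVf ?gt_eqF.
split; last first.
  by rewrite -[_^-1 *+ k]mulr_natr -e ler_wpM2l ?invr_ge0 // ler_nat.
rewrite invr_gt0 ltr0n double_gt0 m0 /= invf_le1 ?ltr0n ?double_gt0 //.
by rewrite ler1n double_gt0.
Qed.

Lemma valid_hard_input (m k L : nat) :
  (0 < m)%N -> (k <= m)%N -> valid_input (hard_input m k L).
Proof.
move=> m0 km; have [/andP[h1 h2] h3] := tiny_size_mul m0 km.
have h4 : 0 <= tiny_size m *+ k by rewrite mulrn_wge0 // ltW.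
rewrite /valid_input all_cat !all_nseq h1 h2 orbT /=.
by apply/orP; right; apply/andP; split; lra.
Qed.

Lemma OPT_ge (sigma : seq R) (B : seq nat) : size B = size sigma ->
  all (gtn (size sigma)) B -> (ncovered sigma B <= OPT sigma)%N.
Proof.
move=> sB /allP hB.
(* ['I_0] has no element to serve as default for [insubd]; without items nothing is covered. *)
have [n0|n0] := posnP (size sigma).
  by move: sB; rewrite n0 => /size0nil ->.
pose o : 'I_(size sigma) := Ordinal n0.
have sz : size (map (insubd o) B) == size sigma by rewrite size_map sB.
rewrite /OPT.
have -> : B = map val (Tuple sz).
  rewrite /= -map_comp -[LHS]map_id; apply/eq_in_map => i iB /=.
  by have /= := hB _ iB; rewrite val_insubd => ->.
exact: (leq_bigmax (F := fun B : (size sigma).-tuple _ => ncovered sigma (map val B))).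
Qed.

Lemma OPT_hard_input (m k L : nat) : (0 < k)%N -> m = (k * L)%N ->
  (L <= OPT (hard_input m k L))%N.
Proof.
move=> k0 mE; have sh : size (hard_input m k L) = (m + L)%N.
  by rewrite size_cat !size_nseq.
(* Round-robin: each bin below [L] gets [k] tiny items, and its large item from [iota 0 L] then
   brings it to exactly 1. *)
pose B1 := flatten (nseq k (iota 0 L)).
have sB1 : size B1 = m by rewrite size_flatten /shape map_nseq sumn_nseq size_iota mE mulnC.
apply: leq_trans (@OPT_ge _ (B1 ++ iota 0 L) _ _); last 2 first.
- by rewrite sh size_cat sB1 size_iota.
- apply/allP => i; rewrite mem_cat sh => h.
  suff : i \in iota 0 L by rewrite mem_iota /=; lia.
  by case/orP: h => // /flattenP[r /nseqP[-> _]].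
rewrite /ncovered -size_filter -[leqLHS](size_iota 0).
apply: uniq_leq_size; rewrite ?iota_uniq // => i iL.
rewrite mem_filter mem_undup mem_cat iL orbT andbT /hard_input.
rewrite bin_level_nseq2 ?size_iota // /B1 count_flatten map_nseq sumn_nseq.
by rewrite count_uniq_mem ?iota_uniq // iL mul1n mulr1n addrC subrK.
Qed.

(* Tiny items alone fill a bin to at most 1/2, so a covered bin holds either two
   large items, or one large item together with at least [k] tiny ones. *)
Lemma ncovered_hard_input (m k L : nat) (B1 B2 : seq nat) :
  (0 < k <= m)%N -> size B1 = m -> size B2 = L ->
  (2 * ncovered (hard_input m k L) (B1 ++ B2) <= L + nbins_with k B1)%N.
Proof.
move=> /andP[k0 km] s1 s2; have m0 : (0 < m)%N by apply: leq_trans km.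
set U := undup (B1 ++ B2).
have uU : uniq U by rewrite undup_uniq.
have LE : L = (\sum_(b <- U) count_mem b B2)%N.
  by rewrite sum_count_mem_uniq // => x xB; rewrite mem_undup mem_cat xB orbT.
rewrite [X in (_ <= X + _)%N]LE.
(* Compared bin by bin: a covered bin weighs 2 on the left, and its large items plus the bonus for
   [k] tiny ones make at least 2. *)
apply: (@leq_trans (\sum_(b <- U) (count_mem b B2 + (k <= count_mem b B1)))%N).
  rewrite /ncovered -sum1_count big_mkcond big_distrr /=.
  apply: leq_sum => b _; case: ifP => //; rewrite /hard_input bin_level_nseq2 //.
  have c1m : (count_mem b B1 <= m)%N by rewrite -s1 count_size.
  have [/andP[e0 _] _] := tiny_size_mul m0 km.
  case: (count_mem b B2) => [|[|c]] // h.
    by have [_ h1] := tiny_size_mul m0 c1m; move: h; rewrite mulr0n; lra.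
  suff -> : (k <= count_mem b B1)%N by [].
  rewrite leqNgt; apply/negP => lt.
  have : tiny_size m *+ (count_mem b B1) < tiny_size m *+ k by rewrite ltr_pMn2l.
  by move: h; rewrite mulr1n; lra.
rewrite big_split /= leq_add2l.
have -> : (\sum_(b <- U) (k <= count_mem b B1) =
  size [seq b <- U | (k <= count_mem b B1)%N])%N.
  by rewrite size_filter -sum1_count [RHS]big_mkcond; apply: eq_bigr => b _; case: (_ <= _)%N.
(* As [0 < k], a bin earning the bonus already occurs in [B1]. *)
rewrite /nbins_with -size_filter; apply: uniq_leq_size; first exact: filter_uniq.
move=> b; rewrite !mem_filter => /andP[h _]; rewrite h mem_undup /=.
by rewrite -has_pred1 has_count; apply: leq_trans h.
Qed.

(** * Online prefixes and finite advice strings *)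

Lemma run_cat (A : online_algorithm R) phi (s1 s2 : seq R) :
  exists2 B2, size B2 = size s2 & run A phi (s1 ++ s2) = run A phi s1 ++ B2.
Proof.
exists (drop (size s1) (run A phi (s1 ++ s2))).
  by rewrite size_drop size_mkseq size_cat addKn.
rewrite -[LHS](cat_take_drop (size s1)); congr (_ ++ _).
rewrite /run /mkseq -map_take take_iota size_cat (minn_idPl (leq_addr _ _)).
apply/eq_in_map => i; rewrite mem_iota /= => h.
(* An item of [s1] is placed from a prefix of [s1], so later items cannot change its bin. *)
by rewrite takel_cat.
Qed.

Lemma nread_cat (A : online_algorithm R) phi (s1 s2 : seq R) :
  (nread A phi s1 <= nread A phi (s1 ++ s2))%N.
Proof.
elim/last_ind: s2 => [|s2 x IH]; first by rewrite cats0.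
by rewrite -rcons_cat; apply: leq_trans IH (nread_rcons _ _ _ _).
Qed.

(** Padding with [false] represents the advice by a finite type of [2 ^ s] strings, over which one
    can sum. *)
Definition tape_of s (f : {ffun 'I_s -> bool}) : tape :=
  fun i => if insub i is Some j then f j else false.

Lemma run_tape_of (A : online_algorithm R) (s : nat) (phi : tape) (sigma : seq R) :
  (nread A phi sigma <= s)%N ->
  exists f : {ffun 'I_s -> bool}, run A phi sigma = run A (tape_of f) sigma.
Proof.
move=> hs; exists [ffun i => phi (val i)].
rewrite /run /mkseq; apply/eq_in_map => i; rewrite mem_iota /= => h.
apply: (proj1 (advice_use _)).
move=> j hj; rewrite /tape_of; have js : (j < s)%N.
  (* Bits read on a prefix of [sigma] are among those read on [sigma]. *)
  apply: leq_trans hj (leq_trans _ hs).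
  by rewrite -[in leqRHS](cat_take_drop i.+1 sigma); apply: nread_cat.
by rewrite insubT /= ffunE.
Qed.

(** Each of the [J] scales needs total weight [mu * m] over the advice strings, while each string
    supplies at most [2 * m] over all scales. The offset [c] leaves at least [2 ^ c] large items at
    every scale, so half of the gain [2 * mu * L] absorbs [2 * b]. Inputs have length
    [m + L <= 2 ^ (J + c).+1]. *)
Lemma advice_lower_bound (A : online_algorithm R) (mu b : R) (s : nat -> nat)
    (c J : nat) :
  0 < mu -> 2 * b <= mu * (2 ^ c)%:R ->
  (forall (n : nat) (sigma : seq R),
    valid_input sigma -> (size sigma <= n)%N ->
    exists phi : tape,
      (ncovered sigma (run A phi sigma))%:R >=
        (1 / 2 + mu) * (OPT sigma)%:R - b /\
      (nread A phi sigma <= s n)%N) ->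
  mu * J%:R <= 2 * (2 ^ s (2 ^ (J + c).+1)%N)%:R.
Proof.
move=> mu0 hb hA; set M := (J + c)%N; set S := s _.
pose m := (2 ^ M)%N; have m0 : (0 < m)%N by rewrite expn_gt0.
have mR : 0 < m%:R :> R by rewrite ltr0n.
pose P (f : {ffun 'I_S -> bool}) := run A (tape_of f) (nseq m (tiny_size m)).
have sP f : size (P f) = m by rewrite size_mkseq size_nseq.
pose N j f := (2 ^ j * nbins_with (2 ^ j) (P f))%N.
have key (j : 'I_J) : mu * m%:R <= (\sum_f N j f)%:R.
  pose L := (2 ^ (M - j))%N.
  have jM : (j <= M)%N by rewrite /M; have := ltn_ord j; lia.
  have mE : m = (2 ^ j * L)%N by rewrite -expnD subnKC.
  have km : (2 ^ j <= m)%N by rewrite leq_exp2l.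
  have Lm : (L <= m)%N by rewrite leq_exp2l // leq_subr.
  have [|phi [hcov hread]] := hA (2 ^ M.+1)%N _ (@valid_hard_input m (2 ^ j) L m0 km).
    by rewrite size_cat !size_nseq expnS -/m; lia.
  have hr1 : (nread A phi (nseq m (tiny_size m)) <= S)%N.
    exact: leq_trans (nread_cat _ _ _ _) hread.
  (* [f] need only reproduce the packing of the tiny items: the covering bound holds for any
     [B2]. *)
  have [f fE] := run_tape_of hr1.
  have [B2 sB2 BE] := run_cat A phi (nseq m (tiny_size m))
    (nseq L (1 - tiny_size m *+ 2 ^ j)).
  rewrite size_nseq in sB2.
  move: hcov; rewrite {2}/hard_input BE fE -/(P f) => hcov.
  have k0 : (0 < 2 ^ j)%N by rewrite expn_gt0.
  have := @ncovered_hard_input m (2 ^ j) L (P f) B2 _ (sP f) sB2.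
  rewrite k0 km => /(_ isT); rewrite -(ler_nat R) natrM natrD => hc2.
  have := OPT_hard_input k0 mE; rewrite -(ler_nat R) => hopt.
  (* Twice the competitive bound is at least [(1 + 2 * mu) * L - 2 * b]; the [L] of the covering
     bound cancels. *)
  have hN : 2 * mu * L%:R - 2 * b <= (nbins_with (2 ^ j) (P f))%:R by nra.
  (* The string [f] varies with [j]; summing over all strings removes this dependence. *)
  apply: (@le_trans _ _ (N j f)%:R); last first.
    by rewrite ler_nat (bigD1 f) //= leq_addr.
  have kR : 0 < (2 ^ j)%:R :> R by rewrite ltr0n.
  have hjJ : (2 ^ j)%:R * (2 ^ c)%:R <= m%:R :> R.
    by rewrite -natrM ler_nat -expnD leq_exp2l // leq_add2r ltnW.
  have mE' : m%:R = (2 ^ j)%:R * L%:R :> R by rewrite -natrM -mE.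
  rewrite natrM; apply: le_trans (ler_wpM2l (ltW kR) hN).
  have h1 : (2 ^ j)%:R * (2 * b) <= (2 ^ j)%:R * (mu * (2 ^ c)%:R) by rewrite ler_pM2l.
  have h2 : mu * ((2 ^ j)%:R * (2 ^ c)%:R) <= mu * m%:R by rewrite ler_pM2l.
  move: h1 h2; rewrite mE'; set X := (2 ^ j)%:R; set Y := (2 ^ c)%:R => h1 h2.
  rewrite mulrBr; nra.
have tot : (\sum_(j < J) \sum_f N j f <= 2 ^ S * (2 * m))%N.
  rewrite exchange_big /=.
  have -> : (2 ^ S * (2 * m) = \sum_(f : {ffun 'I_S -> bool}) 2 * m)%N.
    by rewrite sum_nat_const card_ffun card_bool card_ord.
  by apply: leq_sum => f _; rewrite -(sP f); apply: sum_nbins_with.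
have : \sum_(j < J) mu * m%:R <= (2 ^ S * (2 * m))%:R :> R.
  apply: le_trans (_ : (\sum_(j < J) \sum_f N j f)%:R <= _); last by rewrite ler_nat.
  by rewrite natr_sum; apply: ler_sum.
rewrite sumr_const card_ord -mulr_natr !natrM => h.
by rewrite -(ler_pM2r mR); move: h; set X := _%:R; set Y := J%:R; lra.
Qed.

End Levels.

(** * Asymptotics of the iterated logarithm and the contradiction *)

Lemma sqr_exp2_le (R : realType) (s N : nat) : expR 1 <= N%:R :> R ->
  (s%:R : R) <= 1 / 2 * `|ln (ln (2 ^ N)%:R)| -> (2 ^ s)%:R ^+ 2 <= N%:R :> R.
Proof.
move=> hN hs; have e1 : 2 <= expR 1 :> R by have := expR_ge1Dx (1 : R).
(* This makes the iterated logarithm nonnegative, so the absolute value disappears. *)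
have hln1 : 1 <= ln (2 ^ N)%:R :> R.
  rewrite -ler_expR lnK ?posrE ?ltr0n ?expn_gt0 //.
  by apply: le_trans hN _; rewrite ler_nat ltnW // ltn_expl.
have hlnN : ln (2 ^ N)%:R <= N%:R :> R.
  rewrite -ler_expR lnK ?posrE ?ltr0n ?expn_gt0 //.
  by rewrite -[N%:R]mulr1 expRM_natl natrX lerXn2r // nnegrE ?expR_ge0.
rewrite ger0_norm ?ln_ge0 // in hs.
apply: le_trans hlnN.
(* [2 ^ s <= e ^ s] since [2 <= e], and the factor 1/2 in the hypothesis pays for the square. *)
apply: (@le_trans _ _ (expR (s%:R) ^+ 2)).
  rewrite lerXn2r // ?nnegrE ?expR_ge0 // -[s%:R]mulr1 expRM_natl natrX.
  by rewrite lerXn2r // nnegrE ?expR_ge0.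
rewrite -expRM_natl -[leRHS]lnK ?posrE ?ler_expR; last lra.
by move: hs; set X := ln _ => hs; lra.
Qed.

Theorem theorem2 (R : realType) (A : online_algorithm R) (s : nat -> nat)
    (hs : (fun n : nat => (s n)%:R : R) =o_\oo
          (fun n : nat => ln (ln (n%:R : R)))) (mu : R) (hmu : 0 < mu) :
  ~ competitive_with_advice A (1 / 2 + mu) s.
Proof.
move=> [b hA].
have /eqoP /(_ (1 / 2)) := hs.
have -> : (0 : R) < 1 / 2 by lra.
move=> /(_ isT) [N0 _ hN0].
pose bnd (x : R) := Num.bound `|x|.
have bndP (x : R) n : (bnd x <= n)%N -> x <= n%:R.
  move=> h; apply: le_trans (ler_norm x) _; apply: ltW.
  by apply: lt_le_trans (archi_boundP (normr_ge0 x)) _; rewrite ler_nat.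
pose c := bnd (2 * b / mu).
have hc : 2 * b <= mu * (2 ^ c)%:R.
  rewrite [leRHS]mulrC -ler_pdivrMr //; apply: bndP; exact: ltnW (ltn_expl _ _).
(* The summands ensure, in order: [2 ^ N] is past the little-o threshold, [N <= 2 * J], [e <= N],
   and [9 <= J * mu ^ 2]. *)
pose J := (N0 + c.+1 + bnd (expR 1) + bnd (9 / mu ^+ 2))%N.
have := @advice_lower_bound _ A mu b s c J hmu hc hA.
set N := (J + c).+1; set S := s _ => hJ.
have h1 : (S%:R : R) <= 1 / 2 * `|ln (ln (2 ^ N)%:R)|.
  have /= := hN0 (2 ^ N)%N; rewrite ger0_norm ?ler0n //; apply.
  by apply: (leq_trans _ (ltnW (ltn_expl N (ltnSn 1)))); rewrite /N /J; lia.
have h2 : (2 ^ S)%:R ^+ 2 <= N%:R :> R.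
  by apply: sqr_exp2_le h1; apply: bndP; rewrite /N /J; lia.
have h3 : 9 <= J%:R * mu ^+ 2.
  by rewrite -ler_pdivrMr ?exprn_gt0 //; apply: bndP; exact: leq_addl.
have h4 : N%:R <= 2 * J%:R :> R by rewrite -natrM ler_nat /N /J; lia.
have J0 : 0 < J%:R :> R by rewrite ltr0n /J; lia.
have h5 : (mu * J%:R) ^+ 2 <= (2 * (2 ^ S)%:R) ^+ 2.
  by rewrite lerXn2r // nnegrE mulr_ge0 // ltW.
rewrite !exprMn in h5.
have h6 : 9 * J%:R <= J%:R * mu ^+ 2 * J%:R by rewrite ler_pM2r.
(* [9 * Y <= mu ^ 2 * Y ^ 2 <= 4 * X ^ 2 <= 4 * Z <= 8 * Y], contradicting [0 < Y]. *)
move: h2 h4 h5 h6 J0; clear; set X := (2 ^ S)%:R; set Y := J%:R; set Z := N%:R; nra.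
Qed.
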